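(* Let $k$ be a non-negative integer, let $D$ be a $(k+1)$-arc-strong semicomplete digraph and let $A'\subset A(D)$ be a star-set of size $k$. Then $D$ has a spanning eulerian subdigraph which avoids the arcs in $A'$.
   Context: Digraphs are finite, with no loops and no parallel arcs (two opposite arcs are allowed). A digraph is semicomplete if it has no pair of non-adjacent vertices. A digraph is strong if it has an $(s,t)$-path for each ordered pair of distinct vertices $s,t$; it is $k$-arc-strong if it remains strong after deletion of any set of at most $k-1$ arcs. A set $A'\subset A(D)$ is a star-set in $D$ if the underlying graph of the digraph induced by $A'$ (the undirected simple graph in which $u,v$ are joined by an edge iff $uv\in A'$ or $vu\in A'$) is a collection of vertex-disjoint stars, i.e. every connected component is a star $K_{1,t}$ with $t\ge1$. A digraph is eulerian if it is connected and every vertex has in-degree equal to out-degree; a subdigraph is spanning if it contains all vertices of $D$. *)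

(* Defs.v *)
From mathcomp Require Import all_boot.

Set Implicit Arguments.
Unset Strict Implicit.
Unset Printing Implicit Defensive.

(* A digraph with vertex set V is given by its set A of arcs, the pair (u, v)
   being the arc from u to v; parallel arcs are thereby excluded. *)
Section Digraph.
Variable V : finType.
Implicit Types (A B F : {set V * V}) (C : {set V}) (e : rel V).

Definition arc A : rel V := fun u v => (u, v) \in A.

Definition uadj A : rel V := fun u v => ((u, v) \in A) || ((v, u) \in A).

Definition loopless A := [forall v, (v, v) \notin A].

Definition semicomplete A := [forall u, forall v, (u != v) ==> uadj A u v].

Definition strong A :=
  [forall s, forall t, (s != t) ==> connect (arc A) s t].

(* #|F| < k stands for "at most k - 1 arcs", avoiding truncated subtraction. *)
Definition arc_strong k A :=
  [forall F : {set V * V}, (F \subset A) && (#|F| < k) ==> strong (A :\: F)].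

(* The subgraph of e induced on C is a star K_{1,t} with t >= 1: for some
   centre c in C, the edges are exactly the pairs joining c to another vertex
   of C. *)
Definition is_star e C :=
  (1 < #|C|) &&
  [exists c in C, forall x in C, forall y in C,
     e x y == ((x == c) != (y == c))].

Definition arc_support F : {set V} := [set v | [exists w, uadj F v w]].

Definition star_set A F :=
  (F \subset A) &&
  [forall v in arc_support F, is_star (uadj F) [set w | connect (uadj F) v w]].

Definition outdeg A v := #|[set w | (v, w) \in A]|.
Definition indeg A v := #|[set w | (w, v) \in A]|.

Definition connected A := [forall u, forall v, connect (uadj A) u v].

Definition eulerian A := connected A && [forall v, indeg A v == outdeg A v].

(* A spanning subdigraph keeps the whole vertex set V, so it is determined by
   its arc set B; note that connectedness of B is required on all of V. *)
Definition spanning_eulerian_subdigraph A B := (B \subset A) && eulerian B.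

End Digraph.

(* Main.v *)
Require Import Defs.
From mathcomp Require Import all_boot.
From mathcomp Require Import zify.

Set Implicit Arguments.
Unset Strict Implicit.
Unset Printing Implicit Defensive.

(** Let E be the set of arcs of D outside A'. By Hoffman's circulation theorem E
contains a balanced arc set F meeting every vertex: for vertex sets P, Q covering
V, the arcs of D inside P n Q number at least |P n Q| - 1, a proper cut has at
least k + 1 arcs, and only k arcs are deleted. Choose F with as many pairs of
connected vertices as possible and suppose that it has several classes
(connected components). Local exchanges that would merge classes are then
impossible.

The pairs nonadjacent in E form a star forest. For two classes, the exchange
rules force all arcs between them to have the same direction, unless some vertex
c of one class is nonadjacent to the whole other class, say the class of z. In
that case no path from an out-neighbour of z to an in-neighbour of z, direct or
through c, avoids F. Since the deleted arc between c and z does not cross the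
relevant cut, this cut has at least two arcs of E, all of them in F, so that F
has two arcs from in-neighbours of z to c (or, dually, two arcs from c to
out-neighbours of z). One of them can be rerouted through z without
disconnecting the class of c, which merges the two classes.

Hence the classes form a strong tournament, which contains a 3-cycle of classes;
the star forest is too sparse to prevent an exchange along this cycle. *)

(** * Hoffman's circulation theorem *)

Section Hoffman.
Variables (W : finType) (l u : W -> W -> nat).
Implicit Types (f : W -> W -> nat) (x y a b : W) (X : {set W}).

Let bounded f := forall x y, l x y <= f x y <= u x y.
Let outflow f x := \sum_y f x y.
Let inflow f x := \sum_y f y x.
Let residual f : rel W := fun x y => (f x y < u x y) || (l y x < f y x).
(** One unit of excess, inflow minus outflow, moves from [a] to [b]; the terms are arranged to avoid
    truncated subtraction. *)
Let shifted f a b f' := forall x,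
  inflow f' x + outflow f x + (x == a) = inflow f x + outflow f' x + (x == b).

Lemma sum_bump (g : W -> nat) (p : pred W) y : p y ->
  \sum_(z | p z) (g z + (z == y)) = (\sum_(z | p z) g z).+1.
Proof.
move=> py; rewrite big_split /= -addn1; congr (_ + _).
by rewrite (bigD1 y) //= eqxx big1 ?addn0 // => i /andP[_ /negPf ->].
Qed.

Lemma bump_flow f a b : 
  let g x y := f x y + ((x == a) && (y == b)) in
  (forall x, outflow g x = outflow f x + (x == a)) /\
  (forall x, inflow g x = inflow f x + (x == b)).
Proof.
split=> x; rewrite /outflow /inflow.
  case: eqP => [->|_] /=; last by rewrite addn0; apply: eq_bigr => y _; rewrite addn0.
  by rewrite sum_bump // addn1.
case: eqP => [->|_] /=; last by rewrite addn0; apply: eq_bigr => y _; rewrite andbF addn0.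
rewrite addn1 -(@sum_bump _ xpredT a) //; apply: eq_bigr => y _; by rewrite andbT.
Qed.

(** Flow is raised on [(a, b)] or lowered on [(b, a)]. The last clause keeps the residual arcs away
    from [a], so that the rest of a simple path stays usable. *)
Lemma push_arc f a b : bounded f -> residual f a b ->
  exists f', [/\ bounded f', shifted f a b f' &
    forall x y, x != a -> y != a -> f' x y = f x y].
Proof.
move=> bf /orP[lt_u|lt_l].
  have [ho hi] := bump_flow f a b.
  exists (fun x y => f x y + ((x == a) && (y == b))); split.
  - move=> x y; have := bf x y; case: eqP => [->|_] /=; last lia.
    by case: eqP => [->|_] /=; lia.
  - by move=> x; rewrite ho hi; lia.
  - by move=> x y /negPf-> _; rewrite addn0.
pose g x y := f x y - ((x == b) && (y == a)).
have fE x y : f x y = g x y + ((x == b) && (y == a)).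
  by rewrite /g; case: eqP => [->|_] /=; [case: eqP => [->|_] /=|]; lia.
have [ho hi] := bump_flow g b a.
exists g; split.
- move=> x y; have := bf x y; rewrite /g; case: eqP => [->|_] /=; last lia.
  by case: eqP => [->|_] /=; lia.
- move=> x; have -> : outflow f x = outflow g x + (x == b).
    by rewrite -ho; apply: eq_bigr => y _; rewrite fE.
  have -> : inflow f x = inflow g x + (x == a).
    by rewrite -hi; apply: eq_bigr => y _; rewrite fE.
  lia.
- by move=> x y _ /negPf ya; rewrite /g ya andbF subn0.
Qed.

Lemma push_path p f a : bounded f -> path (residual f) a p -> uniq (a :: p) ->
  exists2 f', bounded f' & shifted f a (last a p) f'.
Proof.
elim: p f a => [|b p IHp] f a bf; first by exists f => // x; lia.
rewrite [path _ _ _]/= [uniq _]/= => /andP[rab pth] /andP[a_p up].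
have [g [bg sg geq]] := push_arc bf rab.
have pthg : path (residual g) b p.
  rewrite -(@eq_in_path _ [pred x | x != a] (residual f)) //.
    by move=> x y xa ya; rewrite /residual !geq.
  by apply/allP => x xp; apply: contraNneq a_p => <-.
have [f' bf' sf'] := IHp g b bg pthg up.
by exists f' => // x; have := sg x; have := sf' x; rewrite /=; lia.
Qed.

Hypothesis hoffman_cond : forall X,
  \sum_(x in ~: X) \sum_(y in X) l x y <= \sum_(x in X) \sum_(y in ~: X) u x y.

(** Starting from [l], the total positive excess is lowered by augmenting along residual paths. A
    vertex of positive excess that reaches no deficient vertex yields a set violating the cut
    condition. *)
Lemma hoffman : (forall x y, l x y <= u x y) ->
  exists f, (forall x y, l x y <= f x y <= u x y) /\
    (forall x, \sum_y f x y = \sum_y f y x).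
Proof.
(* Truncated subtraction makes [viol] the sum of the positive excesses only. *)
move=> lu; pose viol f := \sum_x (inflow f x - outflow f x).
suff main n f : viol f <= n -> bounded f ->
    exists f', bounded f' /\ forall x, outflow f' x = inflow f' x.
  have [f [bf ef]] := main _ l (leqnn _) (fun x y => introT andP (conj (leqnn _) (lu x y))).
  by exists f; split.
elim: n f => [|n IHn] f vf bf; last first.
  have [v0|] := posnP (viol f); first by apply: (IHn f); rewrite ?v0.
  rewrite lt0n sum_nat_eq0 negb_forall => /existsP[a]; rewrite implyTb subn_eq0 -ltnNge => ha.
  have [/existsP[b /andP[/connectP[p pth bE] hb]]|/existsPn noX] :=
      boolP [exists b, connect (residual f) a b && (inflow f b < outflow f b)].
    case/shortenP: pth bE => p' pth' up' _ bE.
    have [f' bf' sf'] := push_path bf pth' up'.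
    rewrite -bE in sf'.
    apply: (IHn f') => //; rewrite -ltnS; apply: leq_trans vf.
    rewrite /viol (bigD1 a) //= [X in _ < X](bigD1 a) //=.
    have sa := sf' a; rewrite eqxx in sa.
    have ab : (a == b) = false by apply/eqP => ab; move: ha hb; rewrite ab; lia.
    rewrite -addSn; apply: leq_add; first by rewrite ab in sa; lia.
    apply: leq_sum => x /negPf xa; have := sf' x; rewrite xa.
    by case: eqP => [->|_]; lia.
  (* Arcs leaving [X] are at their upper bounds and arcs entering it at their lower bounds, yet more
     flow enters [X] than leaves it. *)
  pose X := [set x | connect (residual f) a x].
  have aX : a \in X by rewrite inE connect0.
  have splitX (g : W -> nat) : \sum_y g y = \sum_(y in X) g y + \sum_(y in ~: X) g y.
    by rewrite (bigID (mem X)) /=; congr (_ + _); apply: eq_bigl => y; rewrite in_setC.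
  have lt_oi : \sum_(x in X) outflow f x < \sum_(x in X) inflow f x.
    rewrite (bigD1 a) //= [X in _ < X](bigD1 a) //= -addSn leq_add //.
    by apply: leq_sum => x /andP[]; rewrite inE => xX _; move: (noX x); rewrite xX -leqNgt.
  have eq_o : \sum_(x in X) outflow f x =
      \sum_(x in X) \sum_(y in X) f x y + \sum_(x in X) \sum_(y in ~: X) f x y.
    by rewrite -big_split; apply: eq_bigr => x _; exact: splitX.
  have eq_i : \sum_(x in X) inflow f x =
      \sum_(x in X) \sum_(y in X) f x y + \sum_(x in ~: X) \sum_(y in X) f x y.
    rewrite [X in _ = X + _]exchange_big [X in _ = _ + X]exchange_big -big_split.
    by apply: eq_bigr => x _; exact: splitX.
  rewrite eq_o eq_i ltn_add2l ltnNge in lt_oi; case/negP: lt_oi.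
  have nores x y : x \in X -> y \in ~: X -> ~~ residual f x y.
    rewrite !inE => ax; apply: contraNN => rxy; exact: connect_trans ax (connect1 rxy).
  apply: leq_trans (leq_trans (hoffman_cond X) _).
    apply: leq_sum => x xX; apply: leq_sum => y yX.
    by have := nores _ _ yX xX; rewrite /residual; lia.
  apply: leq_sum => x xX; apply: leq_sum => y yX.
  by have := nores _ _ xX yX; rewrite /residual; lia.
(* No excess is positive, and the excesses sum to zero. *)
exists f; split=> // x.
have le_io y : inflow f y <= outflow f y.
  move: vf; rewrite leqn0 sum_nat_eq0 => /forallP/(_ y); by rewrite implyTb subn_eq0.
have tot : \sum_y outflow f y = \sum_y inflow f y by rewrite /outflow exchange_big.
apply/eqP; rewrite eqn_leq le_io andbT leqNgt; apply/negP => lt.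
suff : \sum_y inflow f y < \sum_y outflow f y by rewrite tot ltnn.
rewrite (bigD1 x) //= [X in _ < X](bigD1 x) //= -addSn leq_add //; exact: leq_sum.
Qed.

End Hoffman.

(** * Balanced arc sets and cuts *)

Section Cuts.
Variable V : finType.
Implicit Types (A B F G : {set V * V}) (X Y Z P Q R : {set V}).

Definition narcs F X Y := \sum_(x in X) \sum_(y in Y) ((x, y) \in F : nat).

Definition balanced F := forall v, indeg F v = outdeg F v.

Lemma outdegE F v : outdeg F v = \sum_w ((v, w) \in F : nat).
Proof. by rewrite /outdeg -sum1dep_card big_mkcond; apply: eq_bigr => w _; case: ifP. Qed.

Lemma indegE F v : indeg F v = \sum_w ((w, v) \in F : nat).
Proof. by rewrite /indeg -sum1dep_card big_mkcond; apply: eq_bigr => w _; case: ifP. Qed.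

Lemma sum_setC X (g : V -> nat) :
  \sum_y g y = \sum_(y in X) g y + \sum_(y in ~: X) g y.
Proof.
by rewrite (bigID (mem X)) /=; congr (_ + _); apply: eq_bigl => y; rewrite in_setC.
Qed.

Lemma narcs_card F X Y : narcs F X Y = #|[set e in F | (e.1 \in X) && (e.2 \in Y)]|.
Proof.
rewrite /narcs pair_big /= -sum1dep_card [RHS]big_mkcond [LHS]big_mkcond /=.
apply: eq_bigr => -[x y] _ /=; by case: (_ && (y \in Y)); rewrite ?andbF ?andbT //; case: (_ \in F).
Qed.

Lemma narcs_setU F X Y Z : [disjoint Y & Z] ->
  narcs F X (Y :|: Z) = narcs F X Y + narcs F X Z.
Proof.
move=> dYZ; rewrite /narcs -big_split; apply: eq_bigr => x _ /=.
rewrite (eq_bigl [predU Y & Z]); last by move=> y; rewrite !inE.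
by rewrite bigU.
Qed.

Lemma narcs_setUl F X Y Z : [disjoint Y & Z] ->
  narcs F (Y :|: Z) X = narcs F Y X + narcs F Z X.
Proof.
move=> dYZ; rewrite /narcs.
rewrite (eq_bigl [predU Y & Z]); last by move=> y; rewrite !inE.
by rewrite bigU.
Qed.

Lemma narcs_sub F X Y X' Y' : X \subset X' -> Y \subset Y' ->
  narcs F X Y <= narcs F X' Y'.
Proof.
move=> sX sY; rewrite !narcs_card; apply: subset_leq_card.
apply/subsetP => -[x y]; rewrite !inE /= => /and3P[-> xX yY].
by rewrite (subsetP sX _ xX) (subsetP sY _ yY).
Qed.

(** With the arcs inside [X] added, the two sides are the sums of out-degrees and of in-degrees over
    [X]. *)
Lemma balanced_cut F X : balanced F -> narcs F X (~: X) = narcs F (~: X) X.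
Proof.
move=> bF; apply/eqP; rewrite -(eqn_add2l (narcs F X X)); apply/eqP.
rewrite /narcs -big_split [RHS]addnC.
rewrite [X in _ = _ + X]exchange_big [X in _ = X + _]exchange_big -big_split /=.
apply: eq_bigr => x _; rewrite [RHS]addnC -!sum_setC.
by rewrite -outdegE -indegE bF.
Qed.

Lemma connect_in (e : rel V) X x y : (forall a b, e a b -> a \in X -> b \in X) ->
  connect e x y -> x \in X -> y \in X.
Proof.
move=> cl /connectP[p pth ->]; elim: p x pth => //= z p IHp x /andP[xz pth] xX.
exact: IHp pth (cl _ _ xz xX).
Qed.

Lemma uadj_sym F : symmetric (uadj F).
Proof. by move=> x y; rewrite /uadj orbC. Qed.

Lemma uconnect_sym F : connect_sym (uadj F).
Proof. exact: sym_connect_sym (@uadj_sym F). Qed.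

Lemma uconnect1 F x y : (x, y) \in F -> connect (uadj F) x y.
Proof. by move=> xy; apply: connect1; rewrite /uadj xy. Qed.

End Cuts.

(** * A balanced arc set outside [A'] meeting every vertex *)

Section Factor.
Variables (k : nat) (V : finType) (D A' : {set V * V}).
Hypotheses (hsc : semicomplete D) (hstrong : arc_strong k.+1 D).
Hypotheses (sAD : A' \subset D) (hcard : #|A'| = k).
Implicit Types (X Y Z P Q R : {set V}).

Let E := D :\: A'.

(** Deleting the arcs that leave [X], if there were at most [k], would keep [D] strong although [X]
    could no longer be left. *)
Lemma cut_card X x y : x \in X -> y \notin X -> k < narcs D X (~: X).
Proof.
move=> xX yX; rewrite ltnNge narcs_card; apply/negP => le_k.
set F := [set e in D | _] in le_k.
move: hstrong => /forallP/(_ F); rewrite ltnS le_k andbT.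
have -> /= : F \subset D by apply/subsetP => e; rewrite inE => /andP[].
move=> /forallP/(_ x)/forallP/(_ y)/implyP.
have xy : x != y by apply: contraNneq yX => <-.
move=> /(_ xy) cxy; case/negP: yX; apply: connect_in cxy xX => a b.
by rewrite /Defs.arc !inE => /andP[nF abD] aX; move: nF; rewrite abD aX /= negbK.
Qed.

Lemma narcs_del X Y : narcs D X Y = narcs E X Y + narcs A' X Y.
Proof.
rewrite /narcs -big_split; apply: eq_bigr => x _; rewrite -big_split.
apply: eq_bigr => y _ /=; rewrite inE.
by have := subsetP sAD (x, y); case: (_ \in A') => //= [->|] //; rewrite addn0.
Qed.

Lemma narcs_del_bound X Y c z : uadj A' c z -> ~~ ((c \in X) && (z \in Y)) ->
  ~~ ((z \in X) && (c \in Y)) -> narcs A' X Y < k.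
Proof.
move=> /orP cz ncz nzc; rewrite narcs_card -hcard; apply: proper_card.
apply/properP; split; first by apply/subsetP => e; rewrite inE => /andP[].
by case: cz => cz; [exists (c, z)|exists (z, c)] => //; rewrite inE cz.
Qed.

Lemma narcs_del_le X Y : narcs A' X Y <= k.
Proof.
rewrite narcs_card -hcard; apply: subset_leq_card.
by apply/subsetP => e; rewrite inE => /andP[].
Qed.

(** It suffices to count the arcs at one vertex [v] of [R], since every other vertex of [R] is
    adjacent to it. *)
Lemma narcs_clique R : #|R| <= (narcs D R R).+1.
Proof.
have [->|[v vR]] := set_0Vmem R; first by rewrite cards0.
rewrite (cardsD1 v) vR add1n ltnS -sum1_card.
have dv : [disjoint [set v] & R :\ v] by rewrite disjoints1 !inE eqxx.
rewrite -{2 3}(setD1K vR) narcs_setUl // !narcs_setU //.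
apply: (@leq_trans (narcs D [set v] (R :\ v) + narcs D (R :\ v) [set v])); last by lia.
rewrite /narcs big_set1 -big_split; apply: leq_sum => u; rewrite big_set1.
rewrite !inE => /andP[uv _]; move: hsc => /forallP/(_ u)/forallP/(_ v); rewrite uv /=.
by case/orP => -> //; rewrite addn1.
Qed.

(** This is the cut condition for the circulation in [eulerian_factor]. If [P] misses a vertex, arcs
    of [D] inside [P :&: Q] and arcs from [P] to [~: P] together number at least
    [#|P :&: Q| - 1 + (k + 1)], and at most [k] arcs are deleted. The case where [Q] misses a vertex
    is symmetric. *)
Lemma narcs_cover P Q : 1 < #|V| -> P :|: Q = setT -> #|P :&: Q| <= narcs E P Q.
Proof.
move=> V1 PQ; have [->|[r]] := set_0Vmem (P :&: Q); first by rewrite cards0.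
rewrite inE => /andP[rP rQ].
have inPQ x : (x \in P) || (x \in Q) by rewrite -in_setU PQ inE.
have [[y yP]|[[y yQ]|[PT QT]]] :
    (exists y, y \notin P) \/ (exists y, y \notin Q) \/ (P = setT /\ Q = setT).
- have [|/subsetPn[y _ yP]] := boolP (setT \subset P); last by left; exists y.
  rewrite subTset => /eqP->; right.
  have [|/subsetPn[y _ yP]] := boolP (setT \subset Q); last by left; exists y.
  by rewrite subTset => /eqP->; right.
- have eQ : Q = (P :&: Q) :|: ~: P.
    by apply/setP => x; move: (inPQ x); rewrite !inE; case: (x \in Q); case: (x \in P).
  have dis : [disjoint P :&: Q & ~: P].
    by rewrite -setI_eq0; apply/eqP/setP => x; rewrite !inE; case: (x \in P); rewrite ?andbF.
  have := narcs_del P Q; rewrite {1}eQ narcs_setU //.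
  have := cut_card rP yP; have := narcs_clique (P :&: Q); have := narcs_del_le P Q.
  have := @narcs_sub _ D (P :&: Q) (P :&: Q) P (P :&: Q) (subsetIl _ _) (subxx _).
  lia.
- have eP : P = (P :&: Q) :|: ~: Q.
    by apply/setP => x; move: (inPQ x); rewrite !inE; case: (x \in Q); rewrite ?andbT ?andbF ?orbF // => ->.
  have dis : [disjoint P :&: Q & ~: Q].
    by rewrite -setI_eq0; apply/eqP/setP => x; rewrite !inE; case: (x \in Q); rewrite ?andbF.
  have := narcs_del P Q; rewrite {1}eP narcs_setUl //.
  have rQ' : r \notin ~: Q by rewrite inE rQ.
  have yQ' : y \in ~: Q by rewrite inE.
  have := cut_card yQ' rQ'; rewrite setCK.
  have := narcs_clique (P :&: Q); have := narcs_del_le P Q.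
  have := @narcs_sub _ D (P :&: Q) (P :&: Q) (P :&: Q) Q (subxx _) (subsetIr _ _).
  lia.
(* Both sets are everything: the cut around each single vertex supplies one outgoing arc of [E]. *)
rewrite PT QT setIT -sum1_card /narcs; apply: leq_sum => x _.
have [y yx] : exists y, y \notin [set x].
  apply/existsP; rewrite -negb_forall; apply: contraL V1 => /forallP al.
  rewrite -leqNgt -(cards1 x); apply: subset_leq_card; apply/subsetP => y _; exact: al.
have := cut_card (set11 x) yx; have := narcs_del [set x] (~: [set x]).
have := narcs_del_le [set x] (~: [set x]).
have := @narcs_sub _ E [set x] (~: [set x]) [set x] setT (subxx _) (subsetT _).
rewrite [X in _ <= X]/narcs big_set1; lia.
Qed.

Lemma big_bool_pair (g : V * bool -> nat) :
  \sum_p g p = \sum_v (g (v, true) + g (v, false)).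
Proof.
rewrite (eq_bigr (fun p => g (p.1, p.2))); last by case.
by rewrite -(pair_bigA _ (fun v b => g (v, b))) /=; apply: eq_bigr => v _; rewrite big_bool.
Qed.

(* Every vertex v is split into an in-copy (v, false) and an out-copy
   (v, true), joined by an arc that must carry at least one unit of flow. *)
Lemma eulerian_factor : 1 < #|V| ->
  exists F : {set V * V}, [/\ F \subset E, balanced F & forall v, 0 < outdeg F v].
Proof.
move=> V1.
pose l (p q : V * bool) : nat := [&& ~~ p.2, q.2 & p.1 == q.1].
pose u (p q : V * bool) : nat :=
  if p.2 then nat_of_bool (~~ q.2 && ((p.1, q.1) \in E))
  else nat_of_bool (q.2 && (p.1 == q.1)) * #|V|.
have lu p q : l p q <= u p q.
  case: p q => [v []] [w []] //; rewrite /l /u /=.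
  by case: (v == w) => //; rewrite mul1n ltnW.
have [|f [bf cf]] := @hoffman _ l u _ lu.
  (* Positive lower bounds into [X] come from the vertices of [P :&: Q], and arcs of [E] leaving [X]
     run from [P] to [Q]. *)
  move=> X; pose P := [set v | (v, true) \in X]; pose Q := [set v | (v, false) \notin X].
  (* A vertex in neither set has its copy arc leaving [X]; the capacity [#|V|] of that arc covers
     all lower bounds at once. *)
  have [v|noPQ] := pickP [pred v | (v \notin P) && (v \notin Q)].
    rewrite /= !inE negbK => /andP[vP vQ].
    apply: (@leq_trans #|V|).
      rewrite big_mkcond big_bool_pair -sum1_card /=; apply: leq_sum => w _.
      rewrite [X in X + _](_ : _ = 0); last by case: ifP => // _; rewrite big1.
      case: ifP => // _; rewrite big_mkcond big_bool_pair (bigD1 w) //= big1.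
        by rewrite /l /= eqxx; do 2!case: (_ \in X).
      move=> x /negPf xw; rewrite /l /= [_ == x]eq_sym xw.
      by do 2!case: (_ \in X).
    rewrite (bigD1 (v, false)) //= (bigD1 (v, true)) ?inE //=.
    by rewrite /u /= eqxx mul1n -addnA leq_addr.
  have PQ : P :|: Q = setT.
    by apply/setP => v; have := noPQ v; rewrite !inE /= negbK; do 2!case: (_ \in X).
  apply: leq_trans (leq_trans (narcs_cover V1 PQ) _).
    rewrite big_mkcond big_bool_pair -sum1_card [X in _ <= X]big_mkcond /=.
    apply: leq_sum => w _.
    rewrite [X in X + _](_ : _ = 0); last by case: ifP => // _; rewrite big1.
    rewrite !inE andbC; case: ifP => //= wf.
    rewrite big_mkcond big_bool_pair (bigD1 w) //= big1.
      by rewrite /l /= eqxx; do 2!case: (_ \in X).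
    move=> x /negPf xw; rewrite /l /= [_ == x]eq_sym xw.
    by do 2!case: (_ \in X).
  rewrite [X in _ <= X]big_mkcond big_bool_pair /narcs big_mkcond /=.
  apply: leq_sum => x _; apply: leq_trans (leq_addr _ _); rewrite !inE.
  case: ifP => // xX; rewrite [X in _ <= X]big_mkcond big_bool_pair big_mkcond /=.
  apply: leq_sum => y _; apply: leq_trans (leq_addl _ _); rewrite !inE.
  by case: ifP => // _; rewrite /u /= inE.
pose F := [set e : V * V | 0 < f (e.1, true) (e.2, false)].
have fE x y : f (x, true) (y, false) = ((x, y) \in F).
  rewrite inE /=; have := bf (x, true) (y, false); rewrite /u /=.
  by case: (_ \in E) => /=; lia.
(* Conservation at the out-copy, and next at the in-copy, equates the flow between the two copies of
   [x] with both degrees of [x] in [F]. *)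
have out x : f (x, false) (x, true) = outdeg F x.
  have := cf (x, true); rewrite !big_bool_pair outdegE => eq.
  transitivity (\sum_v (f (x, true) (v, true) + f (x, true) (v, false))).
    rewrite eq (bigD1 x) //= big1 => [|v /negPf vx]; last first.
      have := bf (v, true) (x, true); have := bf (v, false) (x, true).
      by rewrite /l /u /= vx; lia.
    have := bf (x, true) (x, true); rewrite /u /=; lia.
  apply: eq_bigr => v _; rewrite -fE.
  have := bf (x, true) (v, true); rewrite /u /=; lia.
have inn x : f (x, false) (x, true) = indeg F x.
  have := cf (x, false); rewrite !big_bool_pair indegE => eq.
  transitivity (\sum_v (f (v, true) (x, false) + f (v, false) (x, false))).
    rewrite -eq (bigD1 x) //= big1 => [|v /negPf vx]; last first.
      have := bf (x, false) (v, true); have := bf (x, false) (v, false).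
      by rewrite /l /u /= [x == v]eq_sym vx; lia.
    have := bf (x, false) (x, false); rewrite /u /=; lia.
  apply: eq_bigr => v _; rewrite -fE.
  have := bf (v, false) (x, false); rewrite /u /=; lia.
exists F; split.
- apply/subsetP => -[x y]; rewrite inE /=; have := bf (x, true) (y, false).
  by rewrite /u /=; case: (_ \in E) => //=; lia.
- by move=> v; rewrite -inn out.
- by move=> v; rewrite -out; have := bf (v, false) (v, true); rewrite /l /= eqxx; lia.
Qed.

End Factor.

(** * Merging the classes of a balanced arc set *)

Section Exchange.
Variable V : finType.
Implicit Types (F G : {set V * V}) (R A ps : seq (V * V)) (X Y : {set V}).

Definition exchange F R A := (F :\: [set e in R]) :|: [set e in A].

Lemma narcs_gt0P F X Y :
  reflect (exists e, [/\ e \in F, e.1 \in X & e.2 \in Y]) (0 < narcs F X Y).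
Proof.
rewrite narcs_card card_gt0; apply: (iffP (set0Pn _)) => -[e].
  by rewrite inE => /and3P[eF eX eY]; exists e.
by case=> eF eX eY; exists e; rewrite inE eF eX eY.
Qed.

Lemma narcs_gt1P F X Y : 1 < narcs F X Y -> exists e e',
  [/\ e \in F, e.1 \in X & e.2 \in Y] /\ [/\ e' \in F, e'.1 \in X, e'.2 \in Y & e != e'].
Proof.
rewrite narcs_card => /card_gt1P[e [e' []]].
rewrite !inE => /and3P[? ? ?] /and3P[? ? ?] ?; by exists e, e'.
Qed.

Lemma card_exchange F R A (q : pred (V * V)) :
  uniq R -> uniq A -> {subset R <= F} -> {in A, forall e, e \notin F} ->
  #|[set e in exchange F R A | q e]| + count q R = #|[set e in F | q e]| + count q A.
Proof.
move=> uR uA sR dA.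
have cnt (s : seq (V * V)) : uniq s -> count q s = #|[set e in s | q e]|.
  move=> us; rewrite -size_filter -(card_uniqP (filter_uniq q us)).
  by apply: eq_card => e; rewrite !inE mem_filter andbC.
rewrite !cnt // -!sum1dep_card.
do 4!rewrite [X in _ = X + _]big_mkcond [X in _ = _ + X]big_mkcond
  [X in X + _ = _]big_mkcond [X in _ + X = _]big_mkcond.
rewrite -!big_split; apply: eq_bigr => e _ /=; rewrite !inE.
have := sR e; have := dA e.
case: (e \in R); case: (e \in A); case: (e \in F) => /= h1 h2; case: (q e) => //;
  by [have := h1 isT | have := h2 isT].
Qed.

Lemma outdeg_arcs F v : outdeg F v = #|[set e in F | e.1 == v]|.
Proof.
have inj : injective (pair v : V -> V * V) by move=> x y [].
rewrite /outdeg -(card_imset _ inj).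
apply: eq_card => -[x y]; rewrite !inE /=; apply/imsetP/andP.
  by case=> w; rewrite inE => vw [-> ->].
by case=> xy /eqP xv; exists y; rewrite ?inE -xv.
Qed.

Lemma indeg_arcs F v : indeg F v = #|[set e in F | e.2 == v]|.
Proof.
have inj : injective (fun x : V => (x, v)) by move=> x y [].
rewrite /indeg -(card_imset _ inj).
apply: eq_card => -[x y]; rewrite !inE /=; apply/imsetP/andP.
  by case=> w; rewrite inE => vw [-> ->].
by case=> xy /eqP yv; exists x; rewrite ?inE -yv.
Qed.

Lemma balanced_exchange F R A : balanced F ->
  uniq R -> uniq A -> {subset R <= F} -> {in A, forall e, e \notin F} ->
  (forall v, count (fun e => e.1 == v) A + count (fun e => e.2 == v) R =
             count (fun e => e.2 == v) A + count (fun e => e.1 == v) R) ->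
  balanced (exchange F R A).
Proof.
move=> bF uR uA sR dA cnt v; have := bF v; have := cnt v.
rewrite !outdeg_arcs !indeg_arcs.
have /= := card_exchange (fun e => e.1 == v) uR uA sR dA.
have /= := card_exchange (fun e => e.2 == v) uR uA sR dA.
lia.
Qed.

(* A balanced set of arcs has no bridges. *)
Lemma connect_del F R x y : balanced F -> (x, y) \in F ->
  (forall e, e \in R -> connect (uadj F) e.1 x -> e = (x, y)) ->
  connect (uadj (F :\: [set e in R])) x y.
Proof.
move=> bF xyF sR; rewrite uconnect_sym.
set G := _ :\: _; pose X := [set w | connect (uadj G) y w].
have [//|xX] := boolP (connect _ _ _); have GF a b : uadj G a b -> uadj F a b.
  by rewrite /uadj !inE => /orP[] /andP[_ ->]; rewrite ?orbT.
have : 0 < narcs F (~: X) X.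
  by apply/narcs_gt0P; exists (x, y); rewrite !inE connect0.
rewrite -balanced_cut // => /narcs_gt0P[[p q]]; rewrite !inE /= => -[pqF yp yq].
have pqR : (p, q) \in R.
  apply: contraNT yq => pqR; apply: connect_trans yp (uconnect1 _).
  by rewrite !inE pqR.
have px : connect (uadj F) p x.
  rewrite uconnect_sym; apply: connect_trans (uconnect1 xyF) _.
  by apply: connect_sub yp => a b /GF; apply: connect1.
by case: (sR _ pqR px) => px' _; rewrite -px' yp in xX.
Qed.

End Exchange.

(** * Exchange rules for a maximal balanced arc set *)

Section Merging.
Variables (V : finType) (E F : {set V * V}).
Implicit Types (u v w x y z a b c d : V) (R A ps : seq (V * V)) (X Y : {set V}) (G : {set V * V}).

Definition nontrivial G := forall v, exists2 w, w != v & connect (uadj G) v w.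
(** Merging two classes strictly increases this count, so maximality can be tested by proper
    inclusion of sets of pairs. *)
Definition connected_pairs (G : {set V * V}) := #|[set p | connect (uadj G) p.1 p.2]|.
Definition nonadjacent u v := (u != v) && ~~ uadj E u v.

Hypothesis E_loopless : forall v, (v, v) \notin E.
(** Nonadjacency contains neither a path on four vertices nor a triangle, hence is a star forest. *)
Hypothesis E_star : forall a b c d,
  nonadjacent a b -> nonadjacent b c -> nonadjacent c d -> a = c \/ b = d.
Hypothesis E_strong : forall X x y, x \in X -> y \notin X -> 0 < narcs E X (~: X).
Hypothesis E_cut : forall X x y c z, x \in X -> y \notin X ->
  nonadjacent c z -> (c \in X) = (z \in X) -> 1 < narcs E X (~: X).

Hypotheses (FE : F \subset E) (F_bal : balanced F) (F_nontriv : nontrivial F).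
Hypothesis F_max : forall G, G \subset E -> balanced G -> nontrivial G ->
  connected_pairs G <= connected_pairs F.

Let same := connect (uadj F).
Let step u v := (u == v) || ((u, v) \in F).

Lemma same_sym u v : same u v = same v u. Proof. exact: uconnect_sym. Qed.
Lemma same_trans : transitive same. Proof. exact: connect_trans. Qed.
Lemma same_refl u : same u u. Proof. exact: connect0. Qed.
Hint Resolve same_refl : core.
Lemma F_same u v : (u, v) \in F -> same u v. Proof. exact: uconnect1. Qed.
Lemma step_same u v : step u v -> same u v.
Proof. by case/orP => [/eqP->|/F_same]. Qed.

Lemma same_eql u v w : same u v -> same u w = same v w.
Proof.
move=> uv; apply/idP/idP; apply: same_trans => //; by rewrite same_sym.
Qed.

Lemma same_eqr u v w : same u v -> same w u = same w v.
Proof. by move=> uv; rewrite ![same w _]same_sym; exact: same_eql. Qed.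

Lemma diff_neq u v : ~~ same u v -> u != v.
Proof. by apply: contraNneq => ->. Qed.

Lemma F_neq u v : (u, v) \in F -> u != v.
Proof.
move/(subsetP FE) => uvE; apply: contraTneq uvE => ->; exact: E_loopless.
Qed.

Lemma nonadjacent_sym u v : nonadjacent u v = nonadjacent v u.
Proof. by rewrite /nonadjacent uadj_sym eq_sym. Qed.

Lemma nonadjacentP u v : u != v -> (u, v) \notin E -> (v, u) \notin E -> nonadjacent u v.
Proof. by rewrite /nonadjacent /uadj => -> /negPf-> /negPf->. Qed.

Lemma nonadjacentNE u v : nonadjacent u v -> (u, v) \notin E.
Proof. by case/andP => _; rewrite negb_or => /andP[]. Qed.

Lemma merge_max G : G \subset E -> balanced G ->
  (forall u v, (u, v) \in F -> connect (uadj G) u v) ->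
  forall u v, connect (uadj G) u v -> same u v.
Proof.
move=> GE bG FG u v uv.
have sFG a b : same a b -> connect (uadj G) a b.
  apply: connect_sub => {}a {}b /orP[/FG //|/FG]; by rewrite uconnect_sym.
have ntG : nontrivial G.
  by move=> w; have [w' ww' /sFG] := F_nontriv w; exists w'.
have := F_max GE bG ntG; rewrite leqNgt; apply: contraNT => uvF.
apply: proper_card; apply/properP; split.
  by apply/subsetP => p; rewrite !inE; exact: sFG.
by exists (u, v); rewrite inE.
Qed.

Lemma class_succ (P : pred V) x : P x ->
  (forall a b, same x a -> (a, b) \in F -> P a -> P b) ->
  forall y, same x y -> P y.
Proof.
move=> Px cl y xy; pose X := [set a | same x a && P a].
have succX a b : (a, b) \in F -> a \in X -> b \in X.
  move=> ab; rewrite !inE => /andP[xa Pa].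
  by rewrite (same_trans xa (F_same ab)) (cl a b).
have : y \in X; last by rewrite inE => /andP[].
apply: connect_in (xy) _ => [a b /orP[ab|ba] aX|]; last by rewrite inE same_refl.
  exact: succX ab aX.
apply: contraT => bX.
have : 0 < narcs F (~: X) X by apply/narcs_gt0P; exists (b, a); rewrite !inE in bX aX *.
rewrite -balanced_cut // => /narcs_gt0P[[p q]] /= [pq pX].
by rewrite inE (succX p q).
Qed.

Lemma class_pred (P : pred V) x : P x ->
  (forall a b, same x b -> (a, b) \in F -> P b -> P a) ->
  forall y, same x y -> P y.
Proof.
move=> Px cl y xy; apply: contraT => nPy.
suff : predC P x by rewrite /= Px.
apply: (@class_succ (predC P) y) => //; last by rewrite same_sym.
move=> a b ya ab; apply: contraNN; apply: cl => //.
exact: same_trans xy (same_trans ya (F_same ab)).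
Qed.

Lemma exchange_sub R A : {subset A <= E} -> exchange F R A \subset E.
Proof.
move=> AE; apply/subsetP => e; rewrite !inE => /orP[/andP[_ /(subsetP FE)]|/AE] //.
Qed.

Lemma exchange_keep R A : forall u v, connect (uadj (F :\: [set e in R])) u v ->
  connect (uadj (exchange F R A)) u v.
Proof.
move=> u v; apply: connect_sub => a b ab; apply: connect1; move: ab.
by rewrite /uadj !inE => /orP[] ->; rewrite ?orbT.
Qed.

Lemma exchange_new R A u v : (u, v) \in A -> connect (uadj (exchange F R A)) u v.
Proof. by move=> uvA; apply: uconnect1; rewrite !inE uvA orbT. Qed.

(** Adding new arcs with equal in- and out-degrees keeps balance, so by maximality they cannot join
    classes. *)
Lemma cycle_within A : uniq A -> {subset A <= E} -> {in A, forall e, e \notin F} ->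
  (forall v, count (fun e => e.1 == v) A = count (fun e => e.2 == v) A) ->
  {in A, forall e, same e.1 e.2}.
Proof.
move=> uA AE AF cnt [u v] uvA /=.
apply: (@merge_max (exchange F [::] A)).
- exact: exchange_sub.
- by apply: balanced_exchange => // w; rewrite /= !addn0.
- by move=> a b ab; apply: uconnect1; rewrite !inE ab.
- exact: exchange_new.
Qed.

(* A closed walk through distinct classes which leaves each visited class at x
   and enters it at y, where x = y or (x, y) is an arc of F that the walk
   bypasses. The list ps collects these pairs (x, y). *)
Lemma no_detour ps A : uniq ps -> uniq A -> {subset A <= E} ->
  {in ps, forall e, step e.1 e.2} ->
  {in ps &, forall e e', same e.1 e'.1 -> e = e'} ->
  (forall v, count (fun e => e.1 == v) A = count (fun e => e.1 == v) ps) ->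
  (forall v, count (fun e => e.2 == v) A = count (fun e => e.2 == v) ps) ->
  {in A, forall e, ~~ same e.1 e.2} -> A = [::].
Proof.
move=> ups uA AE stp inj c1 c2 dA; pose R := [seq e <- ps | e.1 != e.2].
have RF : {subset R <= F}.
  by move=> [a b]; rewrite mem_filter /= => /andP[ab /stp]; rewrite /step /= (negPf ab).
case defA: A => [//|[u v] A2].
have uvA : (u, v) \in A by rewrite defA mem_head.
have := dA _ uvA => /= /negP[].
apply: (@merge_max (exchange F R A)).
- exact: exchange_sub.
- apply: balanced_exchange => //; first exact: filter_uniq.
    by move=> e /dA; apply: contraNN; case: e => a b; exact: F_same.
  move=> w; rewrite c1 c2 /R; elim: (ps) => //= -[a b] s IHs /=.
  by case: (eqVneq a b) => [->|_] /=; lia.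
(* A deleted arc is the only one deleted from its class; not being a bridge, it leaves its ends
   connected. *)
- move=> a b ab; have [abR|abR] := boolP ((a, b) \in R); last first.
    by apply: uconnect1; rewrite !inE abR ab.
  apply: exchange_keep; apply: connect_del => // e eR ea.
  move: abR eR; rewrite !mem_filter => /andP[_ abp] /andP[_ ep].
  exact: inj.
- exact: exchange_new.
Qed.

Lemma no_exchange2 x y z w : step x y -> step z w -> ~~ same x z ->
  (x, w) \in E -> (z, y) \in E -> False.
Proof.
move=> xy zw xz xwE zyE; have zx : ~~ same z x by rewrite same_sym.
suff : [:: (x, w); (z, y)] = [::] by [].
apply: (@no_detour [:: (x, y); (z, w)]).
- by rewrite /= inE xpair_eqE (negPf (diff_neq xz)).
- by rewrite /= inE xpair_eqE (negPf (diff_neq xz)).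
- by move=> e; rewrite !inE => /orP[] /eqP->.
- by move=> e; rewrite !inE => /orP[] /eqP->.
- by move=> e e'; rewrite !inE => /orP[] /eqP-> /orP[] /eqP-> //=; rewrite ?(negPf xz) ?(negPf zx).
- by [].
- by move=> v; rewrite /= !addn0 addnC.
- move=> e; rewrite !inE => /orP[] /eqP-> /=.
    by rewrite -(same_eqr _ (step_same zw)).
  by rewrite -(same_eqr _ (step_same xy)).
Qed.

Lemma no_exchange3 x1 y1 x2 y2 x3 y3 : step x1 y1 -> step x2 y2 -> step x3 y3 ->
  ~~ same x1 x2 -> ~~ same x2 x3 -> ~~ same x3 x1 ->
  (x1, y2) \in E -> (x2, y3) \in E -> (x3, y1) \in E -> False.
Proof.
move=> s1 s2 s3 d12 d23 d31 e1 e2 e3.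
have [d21 d32 d13] : [/\ ~~ same x2 x1, ~~ same x3 x2 & ~~ same x1 x3].
  by rewrite ![same x2 x1]same_sym ![same x3 x2]same_sym [same x1 x3]same_sym.
suff : [:: (x1, y2); (x2, y3); (x3, y1)] = [::] by [].
apply: (@no_detour [:: (x1, y1); (x2, y2); (x3, y3)]).
- by rewrite /= !inE !xpair_eqE (negPf (diff_neq d12)) (negPf (diff_neq d13)) (negPf (diff_neq d23)).
- by rewrite /= !inE !xpair_eqE (negPf (diff_neq d12)) (negPf (diff_neq d13)) (negPf (diff_neq d23)).
- by move=> e; rewrite !inE => /or3P[] /eqP->.
- by move=> e; rewrite !inE => /or3P[] /eqP->.
- move=> e e'; rewrite !inE => /or3P[] /eqP-> /or3P[] /eqP-> //=;
  by rewrite ?(negPf d12) ?(negPf d23) ?(negPf d31) ?(negPf d21) ?(negPf d32) ?(negPf d13).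
- by [].
- by move=> v; rewrite /= !addn0 addnA addnC.
- move=> e; rewrite !inE => /or3P[] /eqP-> /=.
  + by rewrite -(same_eqr _ (step_same s2)).
  + by rewrite -(same_eqr _ (step_same s3)).
  + by rewrite -(same_eqr _ (step_same s1)).
Qed.

Lemma step0 u : step u u. Proof. by rewrite /step eqxx. Qed.
Lemma step1 u v : (u, v) \in F -> step u v. Proof. by rewrite /step orbC => ->. Qed.
Hint Resolve step0 step1 : core.

Lemma no_two_cycle u v : ~~ same u v -> (u, v) \in E -> (v, u) \in E -> False.
Proof. by move=> uv; apply: no_exchange2 uv. Qed.


Definition dominates u v := [exists u', exists v', [&& same u u', same v v' & (u', v') \in E]].

Lemma dominatesP u v :
  reflect (exists u' v', [/\ same u u', same v v' & (u', v') \in E]) (dominates u v).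
Proof.
apply: (iffP existsP) => -[u'].
  by case/existsP => v' /and3P[? ? ?]; exists u', v'.
by case=> v' [h1 h2 h3]; exists u'; apply/existsP; exists v'; rewrite h1 h2.
Qed.

Lemma diff_class x0 z0 x z : ~~ same x0 z0 -> same x0 x -> same z0 z -> ~~ same x z.
Proof. by move=> d xx zz; rewrite -(same_eql _ xx) -(same_eqr _ zz). Qed.

(** * Arcs in both directions between two classes *)

Section TwoClasses.
Variables x0 z0 : V.
Hypothesis x0z0 : ~~ same x0 z0.

(** Having an arc into the class of [z0] spreads along arcs [(a, b)] of [F]. If it failed at [b],
    every out-neighbour of [a] in that class would be nonadjacent to [b], and [a] would have an arc
    to the whole class. *)
Lemma row_arc :
  (forall x, same x0 x -> exists2 z, same z0 z & ~~ nonadjacent x z) ->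
  dominates x0 z0 -> forall x, same x0 x -> exists2 z, same z0 z & (x, z) \in E.
Proof.
move=> alive /dominatesP[x1 [z1 [x01 z01 xz1]]] x x0x.
have : [exists w, same z0 w && ((x, w) \in E)]; last first.
  by case/existsP => w /andP[]; exists w.
have x1x : same x1 x by rewrite -(same_eql _ x01).
apply: (class_succ (P := fun x => [exists w, same z0 w && ((x, w) \in E)]) _ _ x1x).
  by apply/existsP; exists z1; rewrite z01.
move=> a b x1a ab /existsP[w /andP[z0w aw]]; apply: contraT => /existsPn nob.
have x0a : same x0 a := same_trans x01 x1a.
have x0b : same x0 b := same_trans x0a (F_same ab).
have nobE z : same z0 z -> (b, z) \notin E by move=> zz; have := nob z; rewrite zz.
have dead z : same z0 z -> (a, z) \in E -> nonadjacent b z.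
  move=> z0z az; apply: nonadjacentP; [|exact: nobE|].
    exact: diff_neq (diff_class x0z0 x0b z0z).
  apply/negP => zb; exact: (no_exchange2 (step1 ab) (step0 z) (diff_class x0z0 x0a z0z) az zb).
(* If this broke at an arc [(p, q)] of [F], then [a], [p], [b], [q] would be a path of nonadjacent
   pairs. *)
have alla z : same z0 z -> (a, z) \in E.
  move=> z0z; have wz : same w z by rewrite -(same_eql _ z0w).
  apply: (class_pred (P := fun z => (a, z) \in E) aw _ wz) => p q wq pq aq.
  have z0q : same z0 q := same_trans z0w wq.
  have z0p : same z0 p by rewrite (same_eqr _ (F_same pq)).
  have dap := diff_class x0z0 x0a z0p.
  apply: contraT => ap.
  have pa : (p, a) \notin E.
    apply/negP => pa; exact: (no_exchange2 (step0 a) (step1 pq) dap aq pa).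
  have nap : nonadjacent a p := nonadjacentP (diff_neq dap) ap pa.
  have nbp : nonadjacent b p.
    apply: nonadjacentP; [|exact: nobE|].
      exact: diff_neq (diff_class x0z0 x0b z0p).
    apply/negP => pb; exact: (no_exchange2 (step1 ab) (step1 pq) dap aq pb).
  have nbq := dead _ z0q aq.
  have npb : nonadjacent p b by rewrite nonadjacent_sym.
  case: (E_star nap npb nbq) => [abE|pqE].
    by move: (F_neq ab); rewrite abE eqxx.
  by move: (F_neq pq); rewrite pqE eqxx.
have [z z0z] := alive _ x0b; by rewrite dead // alla.
Qed.

(** The absence of an arc from [d] spreads from [x] over its class, contradicting the arc that [d]
    must send there. If it broke at an arc [(y, y')] of [F], then [y] would be nonadjacent to [d]
    alone, and following [F] backwards from an out-neighbour of [y] would give the arc [(y, d)]. *)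
Lemma leaf_row x d :
  (forall y, same x0 y -> exists2 z, same z0 z & (y, z) \in E) ->
  (forall z, same z0 z -> exists2 y, same x0 y & (z, y) \in E) ->
  same x0 x -> same z0 d -> nonadjacent x d -> (forall d', nonadjacent x d' -> d' = d) ->
  False.
Proof.
move=> rows cols x0x z0d nxd leaf.
suff nod y : same x0 y -> (d, y) \notin E.
  by have [y /nod/negP] := cols _ z0d.
move=> x0y; have xy : same x y by rewrite -(same_eql _ x0x).
apply: (class_succ (P := fun y => (d, y) \notin E) _ _ xy).
  by rewrite nonadjacentNE // nonadjacent_sym.
move=> {xy x0y} {}y y' xy yy' dy; apply/negP => dy'.
have x0y : same x0 y := same_trans x0x xy.
have dyd := diff_class x0z0 x0y z0d.
have yd : (y, d) \notin E.
  apply/negP => yd; exact: (no_exchange2 (step1 yy') (step0 d) dyd yd dy').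
have nyd : nonadjacent y d := nonadjacentP (diff_neq dyd) yd dy.
have leafy d' : nonadjacent y d' -> d' = d.
  move=> nyd'; have ndy : nonadjacent d y by rewrite nonadjacent_sym.
  by case: (E_star nxd ndy nyd') => [exy|//]; apply: leaf; rewrite exy.
have [w z0w yw] := rows _ x0y.
case/negP: yd; have wd : same w d by rewrite -(same_eql _ z0w).
apply: (class_pred (P := fun z => (y, z) \in E) yw _ wd) => p q wq pq yq.
have z0q : same z0 q := same_trans z0w wq.
have z0p : same z0 p by rewrite (same_eqr _ (F_same pq)).
have dyp := diff_class x0z0 x0y z0p.
apply: contraT => yp; have pd : p = d.
  apply: leafy; apply: nonadjacentP (diff_neq dyp) yp _; apply/negP => py.
  exact: (no_exchange2 (step0 y) (step1 pq) dyp yq py).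
case: (no_exchange2 (step1 yy') (step1 pq) dyp yq); by rewrite pd.
Qed.

End TwoClasses.

(** A nonadjacent pair between the classes has an end that is a leaf of the star forest, and
    [leaf_row] applies. Without such a pair, an arc and its reverse both appear, a two-cycle of
    classes. *)
Lemma no_mutual_domination x0 z0 : ~~ same x0 z0 ->
  (forall x, same x0 x -> exists2 z, same z0 z & ~~ nonadjacent x z) ->
  (forall z, same z0 z -> exists2 x, same x0 x & ~~ nonadjacent z x) ->
  dominates x0 z0 -> dominates z0 x0 -> False.
Proof.
move=> d alive_x alive_z dom1 dom2.
have d' : ~~ same z0 x0 by rewrite same_sym.
have rows := row_arc d alive_x dom1; have cols := row_arc d' alive_z dom2.
have [/existsP[x /existsP[z /and3P[x0x z0z nxz]]]|none] :=
    boolP [exists x, exists z, [&& same x0 x, same z0 z & nonadjacent x z]].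
  have [/forallP leaf|/forallPn[d1]] := boolP [forall d1, nonadjacent x d1 ==> (d1 == z)].
    by apply: (leaf_row d rows cols x0x z0z nxz) => d1 nx; apply/eqP/(implyP (leaf d1)).
  rewrite negb_imply => /andP[nxd1 d1z].
  have nzx : nonadjacent z x by rewrite nonadjacent_sym.
  apply: (leaf_row d' cols rows z0z x0x nzx) => x1 nzx1.
  have nd1x : nonadjacent d1 x by rewrite nonadjacent_sym.
  by case: (E_star nd1x nxz nzx1) => // d1zE; rewrite d1zE eqxx in d1z.
have adj x z : same x0 x -> same z0 z -> ~~ nonadjacent x z.
  move=> x0x z0z; apply: contra none => nxz; apply/existsP; exists x; apply/existsP; exists z.
  by rewrite x0x z0z.
have [z2 [x2 [z02 x02 zx2]]] := dominatesP _ _ dom2.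
have [w z0w xw] := rows _ x02.
have d22 := diff_class d x02 z02.
have wz : same w z2 by rewrite -(same_eql _ z0w).
case: (no_two_cycle d22 _ zx2).
apply: (class_pred (P := fun z => (x2, z) \in E) xw _ wz) => p q wq pq yq.
have z0p : same z0 p by rewrite (same_eqr _ (F_same pq)) (same_trans z0w wq).
have dp := diff_class d x02 z0p.
apply: contraT => x2p; case/negP: (adj _ _ x02 z0p).
apply: nonadjacentP (diff_neq dp) x2p _; apply/negP => px.
exact: (no_exchange2 (step0 x2) (step1 pq) dp yq px).
Qed.

(** * A vertex nonadjacent to a whole class *)

Section DeadVertex.
Variables c z : V.
Hypothesis cz : ~~ same c z.
Hypothesis dead : forall w, same z w -> nonadjacent c w.

Let Vin := [set u | ~~ same z u && ((u, z) \in E)].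
Let Vout := [set u | ~~ same z u && ((z, u) \in E)].

(** The class of [z] has at least two vertices, so [c] is the centre of a star with all of them as
    leaves. *)
Lemma leaf_of_dead w u : same z w -> nonadjacent w u -> u = c.
Proof.
move=> zw nwu; have [w2 w2w ww2] := F_nontriv w.
have nw2c : nonadjacent w2 c by rewrite nonadjacent_sym dead // (same_trans zw).
case: (E_star nw2c (dead zw) nwu) => [w2wE|//].
by rewrite w2wE eqxx in w2w.
Qed.

(** Since [c] alone is nonadjacent to vertices of this class, any other outside vertex that sends it
    one arc sends arcs to all of it. *)
Lemma all_in u w w' : ~~ same z u -> u != c -> same z w -> same z w' ->
  (u, w) \in E -> (u, w') \in E.
Proof.
move=> zu uc zw zw' uw; have ww' : same w w' by rewrite -(same_eql _ zw).
apply: (class_pred (P := fun w => (u, w) \in E) uw _ ww') => p q wq pq uq.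
have zp : same z p by rewrite (same_eqr _ (F_same pq)) (same_trans zw wq).
have dup : ~~ same u p by rewrite -(same_eqr _ zp) same_sym.
apply: contraNT uc => up; apply/eqP/(leaf_of_dead zp).
rewrite nonadjacent_sym; apply: nonadjacentP (diff_neq dup) up _; apply/negP => pu.
exact: (no_exchange2 (step0 u) (step1 pq) dup uq pu).
Qed.

Lemma all_out u w w' : ~~ same z u -> u != c -> same z w -> same z w' ->
  (w, u) \in E -> (w', u) \in E.
Proof.
move=> zu uc zw zw' uw; have ww' : same w w' by rewrite -(same_eql _ zw).
apply: (class_succ (P := fun w => (w, u) \in E) uw _ ww') => p q wp pq pu.
have zp : same z p := same_trans zw wp.
have zq : same z q := same_trans zp (F_same pq).
have dqu : ~~ same q u by rewrite -(same_eql _ zq).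
have dup : ~~ same u p by rewrite -(same_eqr _ zp) same_sym.
apply: contraNT uc => qu; apply/eqP/(leaf_of_dead zq).
apply: nonadjacentP (diff_neq dqu) qu _; apply/negP => uq.
exact: (no_exchange2 (step0 u) (step1 pq) dup uq pu).
Qed.

Lemma c_neither : (c \notin Vin) && (c \notin Vout).
Proof.
have ncz := dead (same_refl z).
have nzc : nonadjacent z c by rewrite nonadjacent_sym.
by rewrite !inE (negPf (nonadjacentNE ncz)) (negPf (nonadjacentNE nzc)) !andbF.
Qed.

Lemma vertex_cases u : [|| same z u, u == c, u \in Vin | u \in Vout].
Proof.
rewrite !inE; have [//|zu] := boolP (same z u); rewrite /=.
have [//|uc] := eqVneq u c; rewrite /=; apply: contraNT uc; rewrite negb_or => /andP[uz zu'].
apply/eqP/(leaf_of_dead (same_refl z)); exact: nonadjacentP (diff_neq zu) zu' uz.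
Qed.

(** Such an arc could be replaced by the detour through [z]. *)
Lemma F_in_out x y : x \in Vin -> y \in Vout -> (x, y) \notin F.
Proof.
rewrite !inE => /andP[zx xz] /andP[zy zyE]; apply/negP => xy.
have dxz : ~~ same x z by rewrite same_sym.
exact: (no_exchange2 (step1 xy) (step0 z) dxz xz zyE).
Qed.

Lemma Vin_Vout x : x \in Vin -> x \notin Vout.
Proof.
move=> xin; apply/negP => xout; move: xin xout.
rewrite !inE => /andP[zx xz] /andP[_ zxE]; exact: no_two_cycle zx zxE xz.
Qed.

(** Otherwise the triangle [z], [y], [x] consists of new arcs and would merge classes. *)
Lemma E_out_in y x : y \in Vout -> x \in Vin -> (y, x) \in E -> (y, x) \in F.
Proof.
move=> yout xin yx; have xy : x != y by apply: contraTneq yout => <-; exact: Vin_Vout.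
move: yout xin; rewrite !inE => /andP[zy zyE] /andP[zx xzE].
have xz : ~~ same x z by rewrite same_sym.
apply: contraT => yxF; case/negP: (zy).
apply: (@cycle_within [:: (z, y); (y, x); (x, z)] _ _ _ _ (z, y)).
- by rewrite /= !inE !xpair_eqE (negPf (diff_neq zx)) (negPf (diff_neq zy)) eq_sym (negPf xy).
- by move=> e; rewrite !inE => /or3P[] /eqP->.
- move=> e; rewrite !inE => /or3P[] /eqP-> //; first exact: contraNN (@F_same _ _) zy.
  exact: contraNN (@F_same _ _) xz.
- by move=> v; rewrite /= !addn0 addnC -!addnA.
- exact: mem_head.
Qed.

(** Otherwise the 4-cycle [z], [y], [c], [x] consists of new arcs. *)
Lemma E_out_c_in y x : y \in Vout -> x \in Vin -> (y, c) \in E -> (c, x) \in E ->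
  (y, c) \in F \/ (c, x) \in F.
Proof.
move=> yout xin yc cx; have xy : x != y by apply: contraTneq yout => <-; exact: Vin_Vout.
have [c_in c_out] := andP c_neither.
have cx' : c != x by apply: contraNneq c_in => ->.
have yc' : y != c by apply: contraNneq c_out => <-.
move: yout xin; rewrite !inE => /andP[zy zyE] /andP[zx xzE].
have xz : ~~ same x z by rewrite same_sym.
have zc : ~~ same z c by rewrite same_sym.
have [|ycF] := boolP ((y, c) \in F); first by left.
right; apply: contraT => cxF; case/negP: (zy).
apply: (@cycle_within [:: (z, y); (y, c); (c, x); (x, z)] _ _ _ _ (z, y)).
- rewrite /= !inE !xpair_eqE (negPf (diff_neq zx)) (negPf (diff_neq zy)) (negPf (diff_neq zc)).
  by rewrite (negPf cx') (negPf yc') [y == x]eq_sym (negPf xy).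
- by move=> e; rewrite !inE => /or4P[] /eqP->.
- move=> e; rewrite !inE => /or4P[] /eqP-> //; first exact: contraNN (@F_same _ _) zy.
  exact: contraNN (@F_same _ _) xz.
- by move=> v; rewrite /= !addn0 addnC -!addnA.
- exact: mem_head.
Qed.

(* Rerouting b -> c -> a through z fails only if it splits the class of c. *)
Lemma reroute_cut b a : b \in Vin -> a \in Vout -> (b, c) \in F -> (c, a) \in F ->
  exists X, [/\ a \in X, b \in X, c \notin X,
    forall p q, (p, q) \in F -> p \in X -> q \notin X -> (p, q) = (b, c) &
    forall p q, (p, q) \in F -> p \notin X -> q \in X -> (p, q) = (c, a)].
Proof.
move=> b_in a_out bc ca; have ab : b != a by apply: contraTneq a_out => <-; exact: Vin_Vout.
move: b_in a_out; rewrite !inE => /andP[zb bz] /andP[za zaE].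
have bz' : ~~ same b z by rewrite same_sym.
pose R := [:: (b, c); (c, a)]; pose A := [:: (b, z); (z, a)].
pose G := exchange F R A; pose X := [set w | connect (uadj G) a w].
have RF : {subset R <= F} by move=> e; rewrite !inE => /orP[] /eqP->.
have AE : {subset A <= E} by move=> e; rewrite !inE => /orP[] /eqP->.
have AF : {in A, forall e, e \notin F}.
  move=> e; rewrite !inE => /orP[] /eqP->; first exact: contraNN (@F_same _ _) bz'.
  exact: contraNN (@F_same _ _) za.
have GE : G \subset E by exact: exchange_sub.
have bG : balanced G.
  apply: balanced_exchange => //.
  - by rewrite /= inE xpair_eqE (negPf (F_neq bc)).
  - by rewrite /= inE xpair_eqE [b == z]eq_sym (negPf (diff_neq zb)).
  - by move=> v; rewrite /= !addn0 [X in X + _]addnC [X in _ + X = _]addnC addnACA.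
have Gbz : connect (uadj G) b z by apply: exchange_new; rewrite mem_head.
have Gza : connect (uadj G) z a by apply: exchange_new; rewrite !inE eqxx orbT.
have Gab : connect (uadj G) a b.
  by rewrite uconnect_sym; apply: connect_trans Gbz Gza.
have keep p q : (p, q) \in F -> (p, q) \notin R -> uadj G p q.
  by move=> pq pqR; rewrite /uadj !inE pq; move: pqR; rewrite !inE => ->.
have cX : c \notin X.
  rewrite inE; apply/negP => ac; case/negP: bz'.
  apply: (merge_max GE bG) => // u v uv.
  have [|uvR] := boolP ((u, v) \in R); last exact/connect1/keep.
  rewrite !inE => /orP[] /eqP[-> ->].
    by apply: connect_trans ac; rewrite uconnect_sym.
  by rewrite uconnect_sym.
exists X; split=> //; first by rewrite inE connect0.
- by rewrite inE.
- move=> p q pq pX qX; have [|pqR] := boolP ((p, q) \in R); last first.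
    case/negP: qX; move: pX; rewrite !inE => ap; exact: connect_trans ap (connect1 (keep _ _ pq pqR)).
  rewrite !inE => /orP[] /eqP // [pc _]; by rewrite -pc pX in cX.
- move=> p q pq pX qX; have [|pqR] := boolP ((p, q) \in R); last first.
    case/negP: pX; move: qX; rewrite !inE => aq; apply: connect_trans aq _.
    by rewrite uconnect_sym; exact: (connect1 (keep _ _ pq pqR)).
  rewrite !inE => /orP[] /eqP // [_ qc]; by rewrite -qc qX in cX.
Qed.

(** The class of [c] meets both [Vin] and [Vout]. By [E_out_c_in], either all arcs of [E] entering
    [Vin] or all those leaving [Vout] lie in [F]. As [c] and [z] are on the same side of that cut,
    there are at least two such arcs. *)
Lemma no_dead_vertex : dominates c z -> dominates z c -> False.
Proof.
move=> /dominatesP[x1 [w1 [cx1 zw1 xw1]]] /dominatesP[w2 [y1 [zw2 cy1 wy1]]].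
have zc : ~~ same z c by rewrite same_sym.
have [c_in c_out] := andP c_neither.
have nE u v : nonadjacent u v -> (u, v) \in E -> False.
  by move=> /nonadjacentNE/negPf->.
have x1_in : x1 \in Vin.
  have zx1 := diff_class zc (same_refl z) cx1; rewrite inE zx1.
  apply: (all_in zx1 _ zw1 (same_refl z) xw1).
  by apply/eqP => e; apply: (nE _ _ _ xw1); rewrite e; exact: dead.
have y1_out : y1 \in Vout.
  have zy1 := diff_class zc (same_refl z) cy1; rewrite inE zy1.
  apply: (all_out zy1 _ zw2 (same_refl z) wy1).
  by apply/eqP => e; apply: (nE _ _ _ wy1); rewrite e nonadjacent_sym; exact: dead.
have z_in : z \notin Vin by rewrite inE same_refl.
have z_out : z \notin Vout by rewrite inE same_refl.
have dom_in w x : same z w -> x \in Vin -> (w, x) \notin E.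
  rewrite inE => zw /andP[zx xz]; apply/negP => wx.
  have xw := all_in zx _ (same_refl z) zw xz.
  have dwx : ~~ same w x by rewrite -(same_eql _ zw).
  apply: (no_two_cycle dwx wx); apply: xw.
  by apply: contraNneq c_in => <-; rewrite inE zx.
have dom_out w y : same z w -> y \in Vout -> (y, w) \notin E.
  rewrite inE => zw /andP[zy zyE]; apply/negP => yw.
  have wy := all_out zy _ (same_refl z) zw zyE.
  have dwy : ~~ same w y by rewrite -(same_eql _ zw).
  apply: (no_two_cycle dwy _ yw); apply: wy.
  by apply: contraNneq c_out => <-; rewrite inE zy.
have narcs_le X Y : (forall e, e \in E -> e.1 \in X -> e.2 \in Y -> e \in F) ->
    narcs E X Y <= narcs F X Y.
  move=> EF; rewrite !narcs_card; apply/subset_leq_card/subsetP => e.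
  by rewrite !inE => /and3P[eE eX eY]; rewrite eX eY EF.
(* Arcs of [F] enter [Vout] only from [c]; without one, membership in [Vout] would spread backwards
   from [y1] to [c]. *)
have exists_out : exists2 a, a \in Vout & (c, a) \in F.
  have [/existsP[a /andP[]]|noa] := boolP [exists a, (a \in Vout) && ((c, a) \in F)].
    by exists a.
  case/negP: c_out; have y1c : same y1 c by rewrite same_sym.
  apply: (class_pred (P := fun u => u \in Vout) y1_out _ y1c) => p q _ pq q_out.
  case/or4P: (vertex_cases p) => // [zp|/eqP pc|p_in].
  - by move: q_out; rewrite inE (same_trans zp (F_same pq)).
  - by case/existsP: noa; exists q; rewrite q_out -pc.
  - by rewrite (negPf (F_in_out p_in q_out)) in pq.
have exists_in : exists2 b, b \in Vin & (b, c) \in F.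
  have [/existsP[b /andP[]]|nob] := boolP [exists b, (b \in Vin) && ((b, c) \in F)].
    by exists b.
  case/negP: c_in; have x1c : same x1 c by rewrite same_sym.
  apply: (class_succ (P := fun u => u \in Vin) x1_in _ x1c) => p q _ pq p_in.
  case/or4P: (vertex_cases q) => // [zq|/eqP qc|q_out].
  - by move: p_in; rewrite inE (same_eqr _ (F_same pq)) zq.
  - by case/existsP: nob; exists p; rewrite p_in -qc.
  - by rewrite (negPf (F_in_out p_in q_out)) in pq.
have ncz := dead (same_refl z).
have [/forallP c_arcs|/forallPn[x]] :=
    boolP [forall x, (x \in Vin) && ((c, x) \in E) ==> ((c, x) \in F)].
- have : 1 < narcs F (~: Vin) Vin.
    apply: leq_trans (narcs_le _ _ _); last first.
      move=> [p x] pxE; rewrite inE /= => p_in x_in.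
      case/or4P: (vertex_cases p) => [zp|/eqP pc|p_in'|p_out].
      + by rewrite (negPf (dom_in _ _ zp x_in)) in pxE.
      + by move: (c_arcs x); rewrite -pc x_in pxE.
      + by rewrite p_in' in p_in.
      + exact: E_out_in.
    rewrite -[X in narcs _ _ X]setCK.
    apply: (@E_cut _ c x1 c z) => //; by rewrite !in_setC ?x1_in ?(negPf c_in) ?(negPf z_in).
  rewrite -balanced_cut // => /narcs_gt1P[[b1 q1] [[b2 q2] [[/= bq1 b1_in q1_in] [/= bq2 b2_in q2_in b12]]]].
  have to_c p q : (p, q) \in F -> p \in Vin -> q \in ~: Vin -> q = c.
    move=> pq p_in; rewrite inE => q_in; case/or4P: (vertex_cases q) => [zq|/eqP //|q_in'|q_out].
    - by move: p_in; rewrite inE (same_eqr _ (F_same pq)) zq.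
    - by rewrite q_in' in q_in.
    - by rewrite (negPf (F_in_out p_in q_out)) in pq.
  have e1 := to_c _ _ bq1 b1_in q1_in; have e2 := to_c _ _ bq2 b2_in q2_in; subst q1 q2.
  have [a a_out ca] := exists_out.
  have [X1 [aX1 bX1 cX1 out1 _]] := reroute_cut b1_in a_out bq1 ca.
  have [X2 [aX2 bX2 cX2 out2 _]] := reroute_cut b2_in a_out bq2 ca.
  (* Since [(c, a)] enters the intersection, some arc of [F] leaves it. That arc ends at [c], hence
     leaves both sets and equals both [(b1, c)] and [(b2, c)]. *)
  have : 0 < narcs F (~: (X1 :&: X2)) (X1 :&: X2).
    by apply/narcs_gt0P; exists (c, a); rewrite !inE aX1 aX2 negb_and cX1.
  rewrite -balanced_cut // => /narcs_gt0P[[p q]] /=.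
  rewrite !inE negb_and => -[pq /andP[pX1 pX2] /orP[qX|qX]].
    have [pb _] := out1 _ _ pq pX1 qX; rewrite pb in pX2.
    by move: b12; rewrite (out2 _ _ bq1 pX2 cX2) eqxx.
  have [pb _] := out2 _ _ pq pX2 qX; rewrite pb in pX1.
  by move: b12; rewrite (out1 _ _ bq2 pX1 cX1) eqxx.
(* An arc from [c] to [Vin] outside [F] forces all arcs of [E] from [Vout] to [c] into [F]; the
   mirror argument yields two arcs of [F] from [c] to [Vout]. *)
rewrite negb_imply => /andP[/andP[x_in cx] cxF].
have : 1 < narcs F Vout (~: Vout).
  apply: leq_trans (narcs_le _ _ _); last first.
    move=> [y q] yqE /= y_out; rewrite in_setC => q_out.
    case/or4P: (vertex_cases q) => [zq|/eqP qc|q_in|q_out'].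
    + by rewrite (negPf (dom_out _ _ zq y_out)) in yqE.
    + rewrite qc in yqE *; case: (E_out_c_in y_out x_in yqE cx) => // cxF'.
      by rewrite cxF' in cxF.
    + exact: E_out_in.
    + by rewrite q_out' in q_out.
  by apply: (@E_cut _ y1 c c z) => //; rewrite (negPf c_out) (negPf z_out).
rewrite balanced_cut // => /narcs_gt1P[[p1 a1] [[p2 a2] [[/= pa1 p1_out a1_out] [/= pa2 p2_out a2_out a12]]]].
have from_c p q : (p, q) \in F -> p \in ~: Vout -> q \in Vout -> p = c.
  move=> pq + q_out; rewrite inE => p_out; case/or4P: (vertex_cases p) => [zp|/eqP //|p_in|p_out'].
  - by move: q_out; rewrite inE (same_trans zp (F_same pq)).
  - by rewrite (negPf (F_in_out p_in q_out)) in pq.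
  - by rewrite p_out' in p_out.
have e1 := from_c _ _ pa1 p1_out a1_out; have e2 := from_c _ _ pa2 p2_out a2_out; subst p1 p2.
have [b b_in bc] := exists_in.
have [X1 [aX1 bX1 cX1 _ in1]] := reroute_cut b_in a1_out bc pa1.
have [X2 [aX2 bX2 cX2 _ in2]] := reroute_cut b_in a2_out bc pa2.
have : 0 < narcs F (X1 :&: X2) (~: (X1 :&: X2)).
  by apply/narcs_gt0P; exists (b, c); rewrite !inE bX1 bX2 negb_and cX1.
rewrite balanced_cut // => /narcs_gt0P[[p q]] /=.
rewrite !inE negb_and => -[pq /orP[pX|pX] /andP[qX1 qX2]].
  have [_ qa] := in1 _ _ pq pX qX1; rewrite qa in qX2.
  by move: a12; rewrite (in2 _ _ pa1 cX2 qX2) eqxx.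
have [_ qa] := in2 _ _ pq pX qX2; rewrite qa in qX1.
by move: a12; rewrite (in1 _ _ pa2 cX1 qX1) eqxx.
Qed.

End DeadVertex.

(** * The tournament of classes *)

Lemma dominates_asym u v : ~~ same u v -> dominates u v -> ~~ dominates v u.
Proof.
move=> uv duv; apply/negP => dvu; have vu : ~~ same v u by rewrite same_sym.
have alive x0 z0 : ~~ same x0 z0 -> dominates x0 z0 -> dominates z0 x0 ->
    forall x, same x0 x -> exists2 z, same z0 z & ~~ nonadjacent x z.
  move=> d d1 d2 x x0x.
  have [/existsP[z /andP[]]|none] := boolP [exists z, same z0 z && ~~ nonadjacent x z].
    by exists z.
  have dx : ~~ same x z0 by rewrite -(same_eql _ x0x).
  case: (@no_dead_vertex x z0 dx).
  - move=> w zw; apply: contraNT none => nxw; apply/existsP; exists w; by rewrite zw.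
  - have [u' [v' [h1 h2 h3]]] := dominatesP _ _ d1; apply/dominatesP; exists u', v'.
    by rewrite -(same_eql _ x0x).
  - have [u' [v' [h1 h2 h3]]] := dominatesP _ _ d2; apply/dominatesP; exists u', v'.
    by rewrite -(same_eql _ x0x).
exact: (no_mutual_domination uv (alive _ _ uv duv dvu) (alive _ _ vu dvu duv) duv dvu).
Qed.

(** Two classes with no arc between them would give four vertices forming a path of nonadjacent
    pairs. *)
Lemma dominates_total u v : ~~ same u v -> dominates u v || dominates v u.
Proof.
move=> uv; apply: contraT; rewrite negb_or => /andP[nuv nvu].
have nadj u' v' : same u u' -> same v v' -> nonadjacent u' v'.
  move=> uu vv; apply: nonadjacentP; first exact: diff_neq (diff_class uv uu vv).
    by apply: contraNN nuv => e; apply/dominatesP; exists u', v'.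
  by apply: contraNN nvu => e; apply/dominatesP; exists v', u'.
have [u2 u2u uu2] := F_nontriv u; have [v2 v2v vv2] := F_nontriv v.
have n1 : nonadjacent v u2 by rewrite nonadjacent_sym nadj ?same_refl.
case: (E_star (nadj _ _ (same_refl u) (same_refl v)) n1 (nadj _ _ uu2 vv2)) => eq.
  by rewrite eq eqxx in u2u.
by rewrite eq eqxx in v2v.
Qed.

Lemma F_succ u : exists v, (u, v) \in F.
Proof.
have [/existsP[v uv]|none] := boolP [exists v, (u, v) \in F]; first by exists v.
have [w wu uw] := F_nontriv u; case/eqP: wu; apply/eqP.
rewrite eq_sym; apply: (class_succ (P := fun x => u == x) _ _ uw) => // a b _ ab /eqP ua.
by case/existsP: none; exists b; rewrite ua.
Qed.

Lemma F_pred u : exists v, (v, u) \in F.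
Proof.
have [/existsP[v uv]|none] := boolP [exists v, (v, u) \in F]; first by exists v.
have [w wu uw] := F_nontriv u; case/eqP: wu; apply/eqP.
rewrite eq_sym; apply: (class_pred (P := fun x => u == x) _ _ uw) => // a b _ ab /eqP ua.
by case/existsP: none; exists a; rewrite ua.
Qed.

Lemma dominates_same u v u' v' : same u u' -> same v v' -> dominates u v = dominates u' v'.
Proof.
move=> uu vv; rewrite /dominates; apply: eq_existsb => x; apply: eq_existsb => y.
by rewrite (same_eql _ uu) (same_eql _ vv).
Qed.

Lemma dominates_arc u v : (u, v) \in E -> dominates u v.
Proof. by move=> uv; apply/dominatesP; exists u, v. Qed.

Lemma dominates_adj u v u' v' : ~~ same u v -> dominates u v -> same u u' -> same v v' ->
  ~~ nonadjacent u' v' -> (u', v') \in E.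
Proof.
move=> uv duv uu vv; apply: contraNT => nE.
apply: nonadjacentP nE _; first exact: diff_neq (diff_class uv uu vv).
apply/negP => vuE; case/negP: (dominates_asym uv duv).
by apply/dominatesP; exists v', u'.
Qed.

Lemma one_class u v : same u v.
Proof.
apply: contraT => uv.
(* An arc leaving [O] cannot end in the class of [u], so it closes a 3-cycle formed by the classes
   of [u], [x2] and [x3]. *)
pose O := [set w | ~~ same u w && dominates u w]; pose V1 := [set w | same u w].
have cases w : [|| same u w, w \in O | ~~ same u w && dominates w u].
  rewrite inE; have [//|uw] := boolP (same u w); exact: dominates_total uw.
have [o oO] : exists o, o \in O.
  have : 0 < narcs E V1 (~: V1) by apply: (@E_strong _ u v); rewrite inE ?same_refl.
  move/narcs_gt0P => [[p q]] /=; rewrite !inE => -[pq up uq]; exists q; rewrite inE uq.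
  by apply/dominatesP; exists p, q.
have uO : u \notin O by rewrite inE same_refl.
have := E_strong oO uO => /narcs_gt0P[[x2 x3]] /= [x23 x2O]; rewrite inE => x3O.
move: x2O; rewrite inE => /andP[ux2 dx2].
have ux3 : ~~ same u x3.
  apply/negP => ux3; case/negP: (dominates_asym ux2 dx2).
  by rewrite (dominates_same (same_refl x2) ux3) dominates_arc.
have dx3 : dominates x3 u.
  by have := cases x3; rewrite (negPf ux3) (negPf x3O).
have d23 : ~~ same x2 x3.
  apply: contraNN x3O => x23s; rewrite inE ux3.
  by rewrite -(dominates_same (same_refl u) x23s).
have [u2 xu2] := F_succ x2; have [u3 ux3F] := F_pred x3.
have x3u : ~~ same x3 u by rewrite same_sym.
have du3 : ~~ same u3 u by rewrite (same_eql _ (F_same ux3F)).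
have out w y : same u w -> same x2 y -> ~~ nonadjacent w y -> (w, y) \in E.
  exact: dominates_adj ux2 dx2.
have inn w y : same u w -> same x3 y -> ~~ nonadjacent w y -> (y, w) \in E.
  move=> uw xy nwy; apply: (dominates_adj x3u dx3 xy uw); by rewrite nonadjacent_sym.
have x3u3 : same x3 u3 by rewrite same_sym F_same.
(* The walk may enter the class of [x2] at [x2] or at [u2], and leave that of [x3] from [x3] or from
   [u3]; a bad vertex is cut off from both choices. *)
pose bad2 w := nonadjacent w x2 && nonadjacent w u2.
pose bad3 w := nonadjacent w x3 && nonadjacent w u3.
(* A bad vertex is the centre of its star, so [x2] is a leaf nonadjacent to it alone. *)
have bad2_inj w w' : bad2 w -> nonadjacent w' x2 -> w' = w.
  move=> /andP[wx wu] w'x; have uw : nonadjacent u2 w by rewrite nonadjacent_sym.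
  have xw : nonadjacent x2 w' by rewrite nonadjacent_sym.
  by case: (E_star uw wx xw) => // ux; move: (F_neq xu2); rewrite ux eqxx.
have bad3_inj w w' : bad3 w -> nonadjacent w' x3 -> w' = w.
  move=> /andP[wx wu] w'x; have uw : nonadjacent u3 w by rewrite nonadjacent_sym.
  have xw : nonadjacent x3 w' by rewrite nonadjacent_sym.
  by case: (E_star uw wx xw) => // ux; move: (F_neq ux3F); rewrite ux eqxx.
have bad w : same u w -> bad2 w || bad3 w.
  move=> uw; apply: contraT; rewrite negb_or => /andP[b2 b3].
  have [y2 sy2 wy2] : exists2 y2, step x2 y2 & (w, y2) \in E.
    move: b2; rewrite negb_and => /orP[] n; [exists x2|exists u2] => //; try exact: step1.
      exact: out. exact: out (F_same xu2) n.
  have [y3 sy3 wy3] : exists2 y3, step y3 x3 & (y3, w) \in E.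
    move: b3; rewrite negb_and => /orP[] n; [exists x3|exists u3] => //; try exact: step1.
      exact: inn. exact: inn x3u3 n.
  have xy3 : same x3 y3 by rewrite same_sym step_same.
  case: (no_exchange3 (step0 w) sy2 sy3 _ _ _ wy2 x23 wy3).
  - by rewrite -(same_eql _ uw).
  - by rewrite -(same_eqr _ xy3).
  - by rewrite -(same_eql _ xy3) -(same_eqr _ uw).
(* Here the walk bypasses [(w', w)]: it leaves at [w'] towards [x2] and returns from [x3] to [w].
   Each of these two pairs is adjacent because [x2] and [x3] have only one nonadjacent vertex
   each. *)
have closing w w' : same u w -> bad2 w -> bad3 w' -> (w', w) \in F -> False.
  move=> uw b2 b3 w'w.
  have uw' : same u w' by rewrite (same_eqr _ (F_same w'w)).
  apply: (no_exchange3 (step1 w'w) (step0 x2) (step0 x3) _ d23 _ _ x23 _).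
  - by rewrite -(same_eql _ uw').
  - by rewrite -(same_eqr _ uw').
  - apply: out => //; apply/negP => n.
    by move: (F_neq w'w); rewrite (bad2_inj _ _ b2 n) eqxx.
  - apply: inn => //; apply/negP => n.
    by move: (F_neq w'w); rewrite (bad3_inj _ _ b3 n) eqxx.
have one2 w w' : bad2 w -> bad2 w' -> w' = w by move=> b /andP[]; move/(bad2_inj _ _ b).
have one3 w w' : bad3 w -> bad3 w' -> w' = w by move=> b /andP[]; move/(bad3_inj _ _ b).
(* At most one vertex is bad in each way, so an [F]-neighbour of [u] is bad in the other way. *)
have [b3|nb3] := boolP (bad3 u).
  have [w uw] := F_succ u; have := bad _ (F_same uw) => /orP[] bw.
    by case: (closing _ _ (F_same uw) bw b3 uw).
  by move: (F_neq uw); rewrite (one3 _ _ b3 bw) eqxx.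
have b2 : bad2 u by have := bad _ (same_refl u); rewrite (negPf nb3) orbF.
have [w wu] := F_pred u; have uw : same u w by rewrite same_sym F_same.
have := bad _ uw => /orP[] bw.
  by move: (F_neq wu); rewrite (one2 _ _ b2 bw) eqxx.
by case: (closing _ _ (same_refl u) b2 bw wu).
Qed.

End Merging.

(** * Star-sets and the final assembly *)

Lemma star_set_path3 (V : finType) (D S : {set V * V}) a b c d : star_set D S ->
  uadj S a b -> uadj S b c -> uadj S c d -> a = c \/ b = d.
Proof.
move=> /andP[_ /forall_inP st] ab bc cd.
have /st/andP[_ /exists_inP[q _ /forall_inP hq]] : b \in arc_support S.
  by rewrite inE; apply/existsP; exists c.
have e x y : connect (uadj S) b x -> connect (uadj S) b y ->
    uadj S x y = ((x == q) != (y == q)).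
  move=> bx cy; have xC : x \in [set w | connect (uadj S) b w] by rewrite inE.
  by apply/eqP/(forall_inP (hq x xC)); rewrite inE.
have ba : connect (uadj S) b a by rewrite uconnect_sym connect1.
have bc' := connect1 bc; have bd := connect_trans bc' (connect1 cd).
move: ab bc cd; rewrite (e a b) // (e b c) // (e c d) //.
(* Each edge has exactly one end at the centre [q]: if [b] is the centre then so is [d], and
   otherwise both [a] and [c] are. *)
case: (eqVneq b q) => [->|_]; last first.
  by case: (eqVneq a q) => // ->; case: (eqVneq c q) => // ->; left.
case: (eqVneq c q) => // _ _ _; case: (eqVneq d q) => // ->; by right.
Qed.

Lemma nontrivial_pos (V : finType) (E G : {set V * V}) : (forall v, (v, v) \notin E) ->
  G \subset E -> (forall v, 0 < outdeg G v) -> nontrivial G.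
Proof.
move=> loopE GE pos v; have /card_gt0P[w] := pos v; rewrite inE => vw.
exists w; last exact: uconnect1.
by apply: contraTneq (subsetP GE _ vw) => ->.
Qed.

Theorem theorem31 (k : nat) (V : finType) (D A' : {set V * V})
    (hD : loopless D)
    (hsc : semicomplete D)
    (hstrong : arc_strong k.+1 D)
    (hstar : star_set D A')
    (hcard : #|A'| = k) :
  exists B : {set V * V},
    spanning_eulerian_subdigraph D B /\ [disjoint B & A'].
Proof.
have [V1|V1] := leqP #|V| 1.
  exists set0; split; last by rewrite -setI_eq0 set0I.
  rewrite /spanning_eulerian_subdigraph sub0set /=; apply/andP; split.
    by apply/forallP => u; apply/forallP => v; rewrite (fintype_le1P V1 u v) connect0.
  by apply/forallP => v; rewrite outdegE indegE; apply/eqP/eq_bigr => w _; rewrite !inE.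
have sAD : A' \subset D by case/andP: hstar.
pose E := D :\: A'.
have loopE v : (v, v) \notin E by rewrite inE (negPf (forallP hD v)) andbF.
have nonadj u v : nonadjacent E u v -> uadj A' u v.
  move=> /andP[uv]; move: hsc => /forallP/(_ u)/forallP/(_ v); rewrite uv /=.
  by rewrite /uadj !inE; do 4!case: (_ \in _).
have starE a b c d : nonadjacent E a b -> nonadjacent E b c -> nonadjacent E c d ->
    a = c \/ b = d.
  by move=> /nonadj ab /nonadj bc /nonadj cd; exact: star_set_path3 hstar ab bc cd.
have strongE (X : {set V}) x y : x \in X -> y \notin X -> 0 < narcs E X (~: X).
  move=> xX yX; have := cut_card hstrong xX yX.
  have := narcs_del_le hcard X (~: X); rewrite (narcs_del sAD) -/E; lia.
(* A nonadjacent pair carries a deleted arc; when it lies on one side, at most [k - 1] deleted arcs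
   cross the cut. *)
have cutE (X : {set V}) x y c z : x \in X -> y \notin X -> nonadjacent E c z ->
    (c \in X) = (z \in X) -> 1 < narcs E X (~: X).
  move=> xX yX /nonadj cz side; have := cut_card hstrong xX yX.
  have := @narcs_del_bound _ _ _ hcard X (~: X) c z cz.
  rewrite !in_setC side andbN (narcs_del sAD) -/E => /(_ isT isT); lia.
pose P (G : {set V * V}) := [&& G \subset E, [forall v, indeg G v == outdeg G v]
  & [forall v, exists w, (w != v) && connect (uadj G) v w]].
have PP (G : {set V * V}) : reflect [/\ G \subset E, balanced G & nontrivial G] (P G).
  apply: (iffP and3P) => -[sG bG nG]; split=> //.
  - by move=> v; apply/eqP/(forallP bG).
  - by move=> v; have /existsP[w /andP[]] := forallP nG v; exists w.
  - by apply/forallP => v; apply/eqP.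
  - by apply/forallP => v; have [w wv vw] := nG v; apply/existsP; exists w; rewrite wv.
have [F0 [F0E F0b F0pos]] := eulerian_factor hsc hstrong sAD hcard V1.
have PF0 : P F0 by apply/PP; split=> //; exact: (nontrivial_pos loopE).
case: (arg_maxnP (@connected_pairs V) PF0) => B /PP[BE Bb Bn] Bmax.
exists B; split; last first.
  by apply/pred0P => e /=; apply/andP => -[/(subsetP BE)]; rewrite inE => /andP[/negPf->].
apply/andP; split; first exact: subset_trans BE (subsetDl _ _).
apply/andP; split; last by apply/forallP => v; apply/eqP.
apply/forallP => u; apply/forallP => v.
apply: (one_class loopE starE strongE cutE BE Bb Bn) => G GE Gb Gn.
by apply: Bmax; apply/PP.
Qed.
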